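(* Let $X$ be a non-empty set and let $d$ be a distance on $X$ that is simultaneously a complete quasimetric and an $H$-distance. Let $\varphi : X \to X$ be a mapping such that: (i) $\varphi$ is continuous (with respect to $\mathcal T(d)$) or $\lambda$-Lipschitzian for some $\lambda>0$; (ii) for each point $x \in X$, writing $x_n = \varphi^n(x)$ for $n\in\mathbb N$, there exists a number $\mu(x)$ with $0\le \mu(x) < 1$ such that $d(\varphi(x_n), \varphi(x_m)) \leq \mu(x)\cdot d(x_n,x_m)$ for all $n, m \in \mathbb N$. Then: 1. $\varphi$ has at least one fixed point. 2. Any periodic point of $\varphi$ is a fixed point of $\varphi$. 3. For every $x\in X$, the Picard orbit $(\varphi^n(x))_{n\in\mathbb N}$ is a Cauchy sequence which converges to some fixed point of $\varphi$. 4. The topological space $(X, \mathcal T(d))$ is first-countable and Hausdorff.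
   Context: $\mathbb N=\{1,2,\dots\}$. A distance on a non-empty set $X$ is a map $d:X\times X\to\mathbb R$ with $d(x,y)\ge 0$ for all $x,y$, and $d(x,y)+d(y,x)=0$ if and only if $x=y$ (no symmetry or triangle inequality is assumed). $B(x,d,r)=\{y\in X: d(x,y)<r\}$. A set $U\subseteq X$ is $d$-open if for each $x\in U$ there is $r>0$ with $B(x,d,r)\subseteq U$; $\mathcal T(d)$ is the topology of all $d$-open sets, and continuity refers to it. A distance $d$ is a quasimetric if $d(x,z)\le d(x,y)+d(y,z)$ for all $x,y,z\in X$. A distance $d$ is an $H$-distance if for any two distinct points $x,y\in X$ there is $\delta>0$ such that $d(x,z)+d(y,z)\ge\delta$ for every $z\in X$. A sequence $(x_n)$ converges to $x$ if $\lim_{n\to\infty}d(x,x_n)=0$; it is Cauchy if $\lim_{n,m\to\infty}d(x_n,x_m)=0$. The distance $d$ is complete if every Cauchy sequence converges to some point of $X$. $\varphi^n$ is the $n$-th iterate of $\varphi$. $\varphi$ is $\lambda$-Lipschitzian ($\lambda>0$) if $d(\varphi(x),\varphi(y))\le\lambda\, d(x,y)$ for all $x,y\in X$. A periodic point of $\varphi$ is a point $x$ with $\varphi^m(x)=x$ for some $m\ge1$. *)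

(* Defs.v *)
From HB Require Import structures.
From mathcomp Require Import all_boot all_order all_algebra.
From mathcomp Require Import all_classical all_reals all_analysis.

Set Implicit Arguments.
Unset Strict Implicit.
Unset Printing Implicit Defensive.

Import Order.TTheory GRing.Theory Num.Theory.
Import numFieldNormedType.Exports.

Local Open Scope classical_set_scope.
Local Open Scope ring_scope.

Section Distances.
Context (R : realType) (X : Type).
Implicit Types (d : X -> X -> R) (u : nat -> X) (phi : X -> X).

Definition is_distance d : Prop :=
  (forall x y, 0 <= d x y) /\ (forall x y, d x y + d y x = 0 <-> x = y).

Definition is_quasimetric d : Prop :=
  is_distance d /\ (forall x y z, d x z <= d x y + d y z).

Definition is_Hdistance d : Prop :=
  is_distance d /\
  (forall x y, x <> y ->
     exists2 delta : R, 0 < delta & forall z, delta <= d x z + d y z).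

(* [d] need not be symmetric: the center is the first argument of [d],
   and likewise for the limit in [dconverges]. *)
Definition dball d (x : X) (r : R) : set X := [set y | d x y < r].

Definition dopen d : set_system X :=
  [set U | forall x, U x -> exists2 r : R, 0 < r & dball d x r `<=` U].

Definition dconverges d u (x : X) : Prop :=
  (fun n => d x (u n)) @ \oo --> (0 : R).

(* Joint limit in the two indices: the filter is the product filter. *)
Definition dcauchy d u : Prop :=
  (fun nm : nat * nat => d (u nm.1) (u nm.2)) @ (\oo, \oo) --> (0 : R).

Definition dcomplete d : Prop :=
  forall u, dcauchy d u -> exists x, dconverges d u x.

Definition lipschitzian d (lambda : R) phi : Prop :=
  forall x y, d (phi x) (phi y) <= lambda * d x y.

Definition fixed_point phi (x : X) : Prop := phi x = x.

Definition periodic_point phi (x : X) : Prop :=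
  exists2 m : nat, (0 < m)%N & iter m phi x = x.

(* The orbit phi x, phi^2 x, ... is indexed in the mathematics by the positive
   integers; its n-th term is [picard_orbit phi x n.-1], and [x] itself is
   not a term. *)
Definition picard_orbit phi (x : X) : nat -> X := fun n => iter n.+1 phi x.

Lemma dopenT d : dopen d setT.
Proof. by move=> x _; exists 1. Qed.

Lemma dopenI d : setI_closed (dopen d).
Proof.
move=> U V dU dV x [/dU[r r0 rU] /dV[s s0 sV]].
exists (Num.min r s) => [|y]; first by rewrite lt_min r0.
by rewrite /dball /= lt_min => /andP[yr ys]; split; [exact: rU|exact: sV].
Qed.

Lemma dopen_bigU d (I : Type) (f : I -> set X) :
  (forall i, dopen d (f i)) -> dopen d (\bigcup_i f i).
Proof.
move=> df x [i _ fix_]; have [r r0 rf] := df i x fix_.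
by exists r => // y /rf fiy; exists i.
Qed.

End Distances.

(* A copy of [X] carrying the topology whose open sets are the [d]-open sets;
   [d] need not satisfy any axiom for this. *)
Definition dspace (R : realType) (X : Type) (d : X -> X -> R) : Type := X.

HB.instance Definition _ (R : realType) (X : Type) (d : X -> X -> R) :=
  gen_eqMixin (dspace d).
HB.instance Definition _ (R : realType) (X : Type) (d : X -> X -> R) :=
  gen_choiceMixin (dspace d).
HB.instance Definition _ (R : realType) (X : Type) (d : X -> X -> R) :=
  @isOpenTopological.Build (dspace d) (dopen d)
    (@dopenT R X d) (@dopenI R X d) (@dopen_bigU R X d).

Lemma open_dspaceE (R : realType) (X : Type) (d : X -> X -> R) :
  @open (dspace d) = dopen d.
Proof. by []. Qed.

Definition first_countable (T : topologicalType) : Prop :=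
  forall x : T, exists B : set_system T,
    [/\ countable B,
        B `<=` nbhs x &
        forall U, nbhs x U -> exists2 V, B V & V `<=` U].

(* Main.v *)
Require Import Defs.
From HB Require Import structures.
From mathcomp Require Import all_boot all_order all_algebra.
From mathcomp Require Import all_classical all_reals all_analysis.
From mathcomp Require Import ring lra.

Set Implicit Arguments.
Unset Strict Implicit.
Unset Printing Implicit Defensive.

Import Order.TTheory GRing.Theory Num.Theory.
Import numFieldNormedType.Exports.

Local Open Scope classical_set_scope.
Local Open Scope ring_scope.

(** Fix [x] and write [u n] for its orbit.  The contraction hypothesis bounds
    every [d (u n) (u m)], in both orders of the indices, by a single constant:
    from [d (u 0) (u n.+1) <= d (u 0) (u 1) + mu * d (u 0) (u n)] it follows
    that [d (u 0) (u n) <= d (u 0) (u 1) / (1 - mu)], and likewise with the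
    arguments exchanged.  Shifting both indices by [k] gains a factor [mu ^+ k],
    so the orbit is Cauchy ([contractive_dcauchy]) and converges to some [y] by
    completeness.

    Without symmetry, a limit in a quasimetric space need not be unique; this is
    what the H-condition repairs.  In the form [Hdistance_eq] it says that two
    points admitting common approximations [z], to within any [e], coincide.
    Everything else uses it.  Continuity of [phi] makes the orbit converge to
    [phi y] as well as to [y], so [phi y = y].  If [x] is periodic then [x]
    recurs in its own orbit, so [x] approximates both the limit [y] and itself,
    and [x = y] is fixed.  Two points without disjoint neighbourhoods have common
    approximations, hence the topology is Hausdorff.

    The triangle inequality enters the topology through [nbhs_dspaceE]: balls
    are open, so they form neighbourhood bases, and those of radius [1 / n] give
    first countability. *)

(** * Convergence and uniqueness of limits *)

Section Convergence.
Context (R : realType) (X : Type) (d : X -> X -> R).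

Lemma distance_ge0 x y : is_distance d -> 0 <= d x y.
Proof. by case. Qed.

Lemma distance_refl x : is_distance d -> d x x = 0.
Proof. by move=> [_ /(_ x x) [_ /(_ erefl)]]; lra. Qed.

Lemma dconvergesP (u : nat -> X) x : is_distance d -> dconverges d u x ->
  forall e, 0 < e -> exists N, forall n, (N <= n)%N -> d x (u n) < e.
Proof.
move=> dd /cvgrPdist_lt ux e /ux [N _ uN]; exists N => n /uN /=.
by rewrite sub0r normrN ger0_norm ?distance_ge0.
Qed.

(** The H-condition as a separation principle; applied to a tail of a sequence
    it is the uniqueness of limits. *)
Lemma Hdistance_eq x y : is_Hdistance d ->
  (forall e, 0 < e -> exists2 z, d x z < e & d y z < e) -> x = y.
Proof.
move=> [_ dH] xy; apply: contrapT => /dH[delta delta0 sep].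
have /xy[z] : 0 < delta / 2 by lra.
by move=> xz yz; have := sep z; lra.
Qed.

End Convergence.

(** * Contractive sequences *)

Section ContractiveSequence.
Context (R : realType) (X : Type) (d : X -> X -> R) (u : nat -> X) (mu : R).
Hypotheses (dq : is_quasimetric d) (mu0 : 0 <= mu) (mu1 : mu < 1).
Hypothesis u_contr : forall n m, d (u n.+1) (u m.+1) <= mu * d (u n) (u m).

Let dd : is_distance d := proj1 dq.
Let triangle : forall x y z, d x z <= d x y + d y z := proj2 dq.

Lemma contractive_shift k n m :
  d (u (k + n)) (u (k + m)) <= mu ^+ k * d (u n) (u m).
Proof.
elim: k => [|k IHk]; first by rewrite expr0 mul1r.
rewrite !addSn (le_trans (u_contr _ _))// exprS -mulrA.
exact: ler_wpM2l.
Qed.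

(** The bound solves [C = c + mu * C], with [c] the cost of one step. *)
Lemma contractive_bounded : exists C, forall n m, d (u n) (u m) <= C.
Proof.
have affine_bound (a : nat -> R) c : 0 <= c -> a 0%N = 0 ->
    (forall n, a n.+1 <= c + mu * a n) -> forall n, a n <= c / (1 - mu).
  move=> c0 a0 aS; have fixC : c + mu * (c / (1 - mu)) = c / (1 - mu).
    have mu1' : 1 - mu != 0 by rewrite subr_eq0 gt_eqF.
    by field.
  elim=> [|n IHn]; first by rewrite a0 divr_ge0// subr_ge0 ltW.
  by rewrite (le_trans (aS n))// -[leRHS]fixC lerD2l ler_wpM2l.
have left_bound := affine_bound (fun n => d (u 0%N) (u n)) _
  (distance_ge0 (u 0%N) (u 1%N) dd) (distance_refl _ dd)
  (fun n => le_trans (triangle _ (u 1%N) _) (lerD (lexx _) (u_contr 0 n))).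
have right_step n :
    d (u n.+1) (u 0%N) <= d (u 1%N) (u 0%N) + mu * d (u n) (u 0%N).
  rewrite (le_trans (triangle _ (u 1%N) _))// addrC.
  by rewrite lerD2l u_contr.
have right_bound := affine_bound (fun n => d (u n) (u 0%N)) _
  (distance_ge0 _ _ dd) (distance_refl _ dd) right_step.
exists (d (u 1%N) (u 0%N) / (1 - mu) + d (u 0%N) (u 1%N) / (1 - mu)) => n m.
by rewrite (le_trans (triangle _ (u 0%N) _))// lerD.
Qed.

Lemma contractive_dcauchy : dcauchy d u.
Proof.
have [C dC] := contractive_bounded.
have muC : (fun k => mu ^+ k * C) @ \oo --> (0 : R).
  rewrite -(mul0r C); apply: cvgM; last exact: cvg_cst.
  by apply: cvg_expr; rewrite ger0_norm.
apply/cvgrPdist_lt => e e0.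
move/cvgrPdist_lt: muC => /(_ e e0)[N _ /(_ N (leqnn N))].
rewrite /= sub0r normrN => muNC.
exists ([set n | N <= n]%N, [set n | N <= n]%N); first by split; exists N.
move=> [n m] [/= Nn Nm]; rewrite sub0r normrN ger0_norm ?distance_ge0//.
rewrite -(subnKC Nn) -(subnKC Nm) (le_lt_trans (contractive_shift _ _ _))//.
rewrite (le_lt_trans _ muNC)// (le_trans _ (ler_norm _))//.
by rewrite ler_wpM2l// exprn_ge0.
Qed.

End ContractiveSequence.

(** * The topology of a quasimetric *)

Section Topology.
Context (R : realType) (X : Type) (d : X -> X -> R).
Hypothesis dq : is_quasimetric d.

Lemma dball_dopen x r : dopen d (dball d x r).
Proof.
move=> y; rewrite /dball /= => xy; exists (r - d x y); first by rewrite subr_gt0.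
by move=> z /=; have := dq.2 x y z; lra.
Qed.

Lemma nbhs_dspaceE (x : dspace d) (U : set (dspace d)) :
  nbhs x U <-> exists2 r : R, 0 < r & dball d x r `<=` U.
Proof.
rewrite nbhsE; split=> [[V [+ Vx] VU]|[r r0 rU]].
  by rewrite open_dspaceE => /(_ x Vx)[r r0 rV]; exists r => // y /rV/VU.
exists (dball d x r) => //; split; first exact: dball_dopen.
by rewrite /dball /= distance_refl//; exact: dq.1.
Qed.

Lemma dspace_first_countable : first_countable (dspace d).
Proof.
move=> x; exists (range (fun n : nat => dball d x n.+1%:R^-1)); split.
- exact: card_image_le.
- by move=> _ [n _ <-]; apply/nbhs_dspaceE; exists n.+1%:R^-1; rewrite ?invr_gt0.
move=> U /nbhs_dspaceE[r r0 rU].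
have [N _ /(_ N (leqnn N)) Nr] := near_infty_natSinv_lt (PosNum r0).
exists (dball d x N.+1%:R^-1); first by exists N.
by move=> y xy; apply: rU; rewrite /dball /=; exact: lt_trans xy Nr.
Qed.

Lemma dspace_hausdorff : is_Hdistance d -> hausdorff_space (dspace d).
Proof.
move=> dH x y xy; apply: (Hdistance_eq dH) => e e0.
have [||z [xz yz]] := xy (dball d x e) (dball d y e).
- by apply/nbhs_dspaceE; exists e.
- by apply/nbhs_dspaceE; exists e.
by exists z.
Qed.

(** Topological continuity reduces to epsilon-delta continuity because the ball
    about [phi y] is a neighbourhood of it; this rests on the triangle
    inequality, while the Lipschitz case is immediate. *)
Lemma regular_dcontinuous (phi : X -> X) :
  continuous (phi : dspace d -> dspace d) \/
    (exists2 lambda : R, 0 < lambda & lipschitzian d lambda phi) ->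
  forall y e, 0 < e ->
    exists2 r, 0 < r & forall z, d y z < r -> d (phi y) (phi z) < e.
Proof.
move=> [phi_cont|[lambda lambda0 phi_lip]] y e e0.
  have /phi_cont/nbhs_dspaceE[r r0 ry] :
      nbhs (phi y : dspace d) (dball d (phi y) e) by apply/nbhs_dspaceE; exists e.
  by exists r.
exists (e / lambda) => [|z]; first exact: divr_gt0.
by rewrite ltr_pdivlMr// mulrC => /(le_lt_trans (phi_lip y z)).
Qed.

End Topology.

(** * Limits of orbits *)

Section Orbits.
Context (R : realType) (X : Type) (d : X -> X -> R) (phi : X -> X).
Hypothesis dH : is_Hdistance d.

(** The orbit shifted by one is the image of the orbit: its terms approximate
    both [phi y] and [y]. *)
Lemma orbit_limit_fixed x y :
  (forall e, 0 < e ->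
    exists2 r, 0 < r & forall z, d y z < r -> d (phi y) (phi z) < e) ->
  dconverges d (picard_orbit phi x) y -> fixed_point phi y.
Proof.
move=> phi_cont /(dconvergesP dH.1) xy; apply: (Hdistance_eq dH) => e e0.
have [r /xy[N Nr] ry] := phi_cont e e0.
have [M Me] := xy e e0.
exists (picard_orbit phi x (maxn N M).+1).
  by apply: ry; apply: Nr; exact: leq_maxl.
by apply: Me; rewrite leqW// leq_maxr.
Qed.

Lemma periodic_orbit_limit x y :
  periodic_point phi x -> dconverges d (picard_orbit phi x) y -> x = y.
Proof.
move=> [m m0 phim] /(dconvergesP dH.1) xy; apply: (Hdistance_eq dH) => e e0.
exists x; first by rewrite distance_refl//; exact: dH.1.
have [N /(_ (N.+1 * m).-1)] := xy e e0.
(* The term of index [n] is the iterate of order [n.+1], whence [.-1]. *)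
have Nm : (N < N.+1 * m)%N by exact: leq_pmulr.
have -> : picard_orbit phi x (N.+1 * m).-1 = x.
  by rewrite /picard_orbit prednK ?(leq_trans _ Nm)// iterM iter_fix.
by apply; rewrite -ltnS prednK// (leq_trans _ Nm).
Qed.

End Orbits.

Theorem corollary2p5 (R : realType) (X : Type) (d : X -> X -> R) (phi : X -> X)
  (X_nonempty : [set: X] !=set0)
  (d_quasimetric : is_quasimetric d)
  (d_complete : dcomplete d)
  (d_Hdistance : is_Hdistance d)
  (phi_regular :
     continuous (phi : dspace d -> dspace d) \/
     (exists2 lambda : R, 0 < lambda & lipschitzian d lambda phi))
  (phi_contractive_on_orbits :
     forall x : X, exists mu : R,
       [/\ 0 <= mu, mu < 1 &
           forall n m : nat,
             d (phi (picard_orbit phi x n)) (phi (picard_orbit phi x m))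
               <= mu * d (picard_orbit phi x n) (picard_orbit phi x m)]) :
  [/\ exists x : X, fixed_point phi x,
      forall x : X, periodic_point phi x -> fixed_point phi x,
      forall x : X,
        dcauchy d (picard_orbit phi x) /\
        (exists2 y : X, fixed_point phi y & dconverges d (picard_orbit phi x) y) &
      first_countable (dspace d) /\ hausdorff_space (dspace d)].
Proof.
have orbit_cauchy x : dcauchy d (picard_orbit phi x).
  have [mu [mu0 mu1 contr]] := phi_contractive_on_orbits x.
  exact: contractive_dcauchy mu0 mu1 contr.
have orbit_limit x :
    exists2 y, fixed_point phi y & dconverges d (picard_orbit phi x) y.
  have [y xy] := d_complete _ (orbit_cauchy x); exists y => //.
  apply: orbit_limit_fixed xy => //.
  exact: regular_dcontinuous.
split.
- by have [x _] := X_nonempty; have [y] := orbit_limit x; exists y.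
- move=> x x_per; have [y y_fix xy] := orbit_limit x.
  by rewrite (periodic_orbit_limit d_Hdistance x_per xy).
- by move=> x; split; [exact: orbit_cauchy|exact: orbit_limit].
- by split; [exact: dspace_first_countable|exact: dspace_hausdorff].
Qed.
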